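(* Let $A, B, C \subseteq \mathbb{R}$ and let $f: A\to\mathbb{R}$, $g: B\to\mathbb{R}$, $h: C\to\mathbb{R}$ be polynomial or rational functions. Consider the equation $\sqrt{f(x)}-\sqrt{g(x)}=h(x)$ in the real unknown $x\in A\cap B\cap C$. Define $$S_0 = \{ x\in A\cap B\cap C \mid 4[h(x)]^2 f(x) = [f(x)+[h(x)]^2-g(x)]^2 \},$$ $$A_1 = \{ x\in A\cap B\cap C \mid f(x)\geq 0 \},$$ $$A_2 = \{ x\in A\cap B\cap C \mid \sqrt{f(x)}-h(x)\geq 0 \},$$ $$A_3 = \{ x\in A\cap B\cap C \mid h(x)\,[f(x)+[h(x)]^2-g(x)] \geq 0 \},$$ $$B_1 = \{ x\in A\cap B\cap C \mid f(x) = g(x) <0 \text{ and } h(x) =0 \}.$$ Then the set $S_1$ of all strong solutions of the equation is $$S_1 = S_0 \cap A_1 \cap A_2 \cap A_3,$$ and the set $S_2$ of all formal solutions of the equation is $$S_2 = (S_0 \cap A_1 \cap A_2 \cap A_3)\cup B_1.$$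
   Context: Square root convention: for a real number $a\ge 0$, $\sqrt{a}$ is the unique nonnegative real square root; for a real number $a<0$, $\sqrt{a}=i\sqrt{-a}$, which is purely imaginary with positive imaginary part. The set $A_2$ is used only through its intersection with $A_1$, where $f(x)\ge 0$, so the inequality defining it is an inequality between real numbers there. A formal solution of an equation involving square roots is a real number $x$ (in the common domain $A\cap B\cap C$ of the functions appearing in it) that satisfies the equation as an equality of complex numbers, where the radicals are allowed to evaluate to imaginary numbers under the convention above. A strong solution is a real number $x$ in this common domain that satisfies the equation and for which every expression appearing under a radical sign in the original equation (here $f(x)$ and $g(x)$) is nonnegative. *)

(* Defs.v *)
From mathcomp Require Import all_boot all_order all_algebra.
From mathcomp Require Import all_classical all_reals.
From mathcomp Require Import complex.

Set Implicit Arguments.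
Unset Strict Implicit.
Unset Printing Implicit Defensive.

Import Order.TTheory GRing.Theory Num.Theory.

Local Open Scope classical_set_scope.
Local Open Scope complex_scope.
Local Open Scope ring_scope.

(* A function f : A -> R is represented by a total function R -> R of which
   only the values on A matter. *)
Definition polynomial_on (R : realType) (A : set R) (f : R -> R) : Prop :=
  exists p : {poly R}, forall x, A x -> f x = p.[x].

Definition rational_on (R : realType) (A : set R) (f : R -> R) : Prop :=
  exists p q : {poly R},
    q != 0 /\ forall x, A x -> q.[x] != 0 /\ f x = p.[x] / q.[x].

(* For a < 0 this is i * sqrt(-a); Num.sqrt alone would be 0 there. *)
Definition csqrt (R : realType) (a : R) : R[i] :=
  if 0 <= a then (Num.sqrt a)%:C else 0 +i* Num.sqrt (- a).

Definition formal_solutions (R : realType) (D : set R) (f g h : R -> R)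
    : set R :=
  [set x | D x /\ csqrt (f x) - csqrt (g x) = (h x)%:C].

Definition strong_solutions (R : realType) (D : set R) (f g h : R -> R)
    : set R :=
  [set x | [/\ D x, csqrt (f x) - csqrt (g x) = (h x)%:C,
               0 <= f x & 0 <= g x]].

(* Main.v *)
Require Import Defs.
From mathcomp Require Import all_boot all_order all_algebra.
From mathcomp Require Import all_classical all_reals.
From mathcomp Require Import complex ring lra.

Set Implicit Arguments.
Unset Strict Implicit.
Unset Printing Implicit Defensive.

Import Order.TTheory GRing.Theory Num.Theory.

Local Open Scope classical_set_scope.
Local Open Scope complex_scope.
Local Open Scope ring_scope.

(** Write [a], [b], [c] for the values of [f], [g], [h] at a point.

    When [a] and [b] are nonnegative the equation is real. For [s = sqrt a] it
    says [sqrt b = s - c], that is, [s - c >= 0] and [b = (s - c)^2]. Expanding,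
    the last equation is [2 c s = a + c^2 - b], and squaring it gives the
    equation of [S0]. Squaring loses only the relative sign of the two sides;
    as [s >= 0], the left side cannot have the sign opposite to [c], and the
    condition [0 <= c (a + c^2 - b)] of [A3] says the same of the right side.
    When [c = 0], both sides vanish. The nonnegativity of [b] comes out as a
    consequence, since [b] is a square. This is [sqrt_sub_eqP].

    When [a] or [b] is negative, the corresponding root is a nonzero imaginary
    number while [c] is real, so the imaginary parts must cancel: both radicands
    are negative and equal, and then [c = 0]. Hence the formal solutions
    that are not strong are exactly the points of [B1]; this is
    [csqrt_sub_eqP]. All of this is pointwise. *)

Lemma csqrt_ge0E (R : realType) (a : R) : 0 <= a -> csqrt a = (Num.sqrt a)%:C.
Proof. by rewrite /csqrt => ->. Qed.

Lemma csqrt_lt0E (R : realType) (a : R) :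
  a < 0 -> csqrt a = 0 +i* Num.sqrt (- a).
Proof. by rewrite /csqrt leNgt => ->. Qed.

(** If [x = - y], the two sign conditions give [c y = 0]. They carry no
    information when [c = 0], hence the hypothesis that [y] then vanishes. *)
Lemma eq_sqr_same_sign (R : realDomainType) (c x y : R) :
    x ^+ 2 = y ^+ 2 -> 0 <= c * x -> 0 <= c * y -> (c = 0 -> y = 0) -> x = y.
Proof.
move=> /eqP; rewrite eqf_sqr => /orP[/eqP //|/eqP xNy].
rewrite xNy mulrN oppr_ge0 => cy_le0 cy_ge0 c0y0.
have /eqP : c * y = 0 by apply/le_anti/andP.
by rewrite mulf_eq0 => /orP[/eqP/c0y0|/eqP] ->; rewrite oppr0.
Qed.

(** Both sides amount to [2 c sqrt a = a + c^2 - b], i.e. [b = (sqrt a - c)^2],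
    together with [c <= sqrt a]. *)
Lemma sqrt_sub_eqP (R : rcfType) (a b c : R) : 0 <= a ->
  (0 <= b /\ Num.sqrt a - Num.sqrt b = c) <->
  [/\ 4 * c ^+ 2 * a = (a + c ^+ 2 - b) ^+ 2, 0 <= Num.sqrt a - c
    & 0 <= c * (a + c ^+ 2 - b)].
Proof.
move=> a_ge0; have s_ge0 := sqrtr_ge0 a; have sE := sqr_sqrtr a_ge0.
move: (Num.sqrt a) s_ge0 sE => s s_ge0 <-.
have c2s_ge0 : 0 <= c * (2 * c * s).
  have -> : c * (2 * c * s) = 2 * (c ^+ 2 * s) by ring.
  by rewrite mulr_ge0 // mulr_ge0 ?sqr_ge0.
split=> [[b_ge0 eqc]|[sqE sc_ge0 cK_ge0]].
  have t_ge0 := sqrtr_ge0 b; have tE := sqr_sqrtr b_ge0.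
  have KE : s ^+ 2 + c ^+ 2 - b = 2 * c * s by rewrite -tE -eqc; ring.
  by split; [rewrite KE; ring | rewrite -eqc; lra | rewrite KE].
have KE : s ^+ 2 + c ^+ 2 - b = 2 * c * s.
  apply: (eq_sqr_same_sign _ cK_ge0 c2s_ge0); first by rewrite -sqE; ring.
  by move=> ->; rewrite mulr0 mul0r.
have -> : b = (s - c) ^+ 2.
  have -> : b = s ^+ 2 + c ^+ 2 - (s ^+ 2 + c ^+ 2 - b) by ring.
  by rewrite KE; ring.
by split; [exact: sqr_ge0 | rewrite sqrtr_sqr ger0_norm //; ring].
Qed.

(** Comparing imaginary parts excludes a single negative radicand, and forces
    two negative radicands to be equal. *)
Lemma csqrt_sub_eqP (R : realType) (a b c : R) :
  csqrt a - csqrt b = c%:C <->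
  [/\ 0 <= a, 0 <= b & Num.sqrt a - Num.sqrt b = c] \/
  [/\ a = b, b < 0 & c = 0].
Proof.
split; last first.
  move=> [[a_ge0 b_ge0 <-]|[-> _ ->]]; last by rewrite subrr.
  by rewrite !csqrt_ge0E // rmorphB.
have [a_ge0|a_lt0] := leP 0 a; have [b_ge0|b_lt0] := leP 0 b.
- by rewrite !csqrt_ge0E // -rmorphB => -[eqc]; left.
- rewrite csqrt_ge0E // csqrt_lt0E // => -[_ im0].
  have := sqrtr_gt0 (- b); rewrite oppr_gt0 b_lt0; lra.
- rewrite csqrt_lt0E // csqrt_ge0E // => -[_ im0].
  have := sqrtr_gt0 (- a); rewrite oppr_gt0 a_lt0; lra.
rewrite !csqrt_lt0E // => -[re0 im0]; right; split=> //; last by lra.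
apply: oppr_inj; rewrite -[LHS]sqr_sqrtr ?oppr_ge0 ?ltW //.
by rewrite -[RHS]sqr_sqrtr ?oppr_ge0 ?ltW //; congr (_ ^+ 2); lra.
Qed.

(* The inequality in A2 is in R[i], where 0 <= z means that z is real and
   nonnegative; on A1 it is the inequality between real numbers. *)
Theorem proposition4p2 (R : realType) (A B C : set R) (f g h : R -> R)
    (hf : polynomial_on A f \/ rational_on A f)
    (hg : polynomial_on B g \/ rational_on B g)
    (hh : polynomial_on C h \/ rational_on C h) :
  let D := A `&` B `&` C in
  let S0 := [set x | D x /\
    4 * h x ^+ 2 * f x = (f x + h x ^+ 2 - g x) ^+ 2] in
  let A1 := [set x | D x /\ 0 <= f x] in
  let A2 := [set x | D x /\ 0 <= csqrt (f x) - (h x)%:C] in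
  let A3 := [set x | D x /\ 0 <= h x * (f x + h x ^+ 2 - g x)] in
  let B1 := [set x | [/\ D x, f x = g x, g x < 0 & h x = 0]] in
  strong_solutions D f g h = S0 `&` A1 `&` A2 `&` A3 /\
  formal_solutions D f g h = (S0 `&` A1 `&` A2 `&` A3) `|` B1.
Proof.
move=> D S0 A1 A2 A3 B1.
have csqrt_sub_ge0 a c : 0 <= a ->
    (0 <= csqrt a - c%:C) = (0 <= Num.sqrt a - c).
  by move=> a_ge0; rewrite csqrt_ge0E // -rmorphB ler0c.
have strongE : strong_solutions D f g h = S0 `&` A1 `&` A2 `&` A3.
  apply/seteqP; split=> x /=.
    move=> [Dx /csqrt_sub_eqP[[_ _ eqh]|[_ g_lt0 _]] f_ge0 g_ge0]; last by lra.
    have [sqE sh_ge0 hK_ge0] := (sqrt_sub_eqP _ _ f_ge0).1 (conj g_ge0 eqh).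
    by do !split=> //; rewrite csqrt_sub_ge0.
  move=> [[[[Dx sqE] [_ f_ge0]] [_ sh_ge0]] [_ hK_ge0]].
  rewrite csqrt_sub_ge0 // in sh_ge0.
  have [g_ge0 eqh] := (sqrt_sub_eqP _ _ f_ge0).2 (And3 sqE sh_ge0 hK_ge0).
  by split=> //; apply/csqrt_sub_eqP; left.
split=> //; rewrite -strongE; apply/seteqP; split=> x /=.
  move=> [Dx eqh]; case/csqrt_sub_eqP: (eqh) => [[f_ge0 g_ge0 _]|[fg g_lt0 h0]].
    by left.
  by right.
move=> [[Dx eqh _ _]|[Dx fg g_lt0 h0]]; split=> //.
by apply/csqrt_sub_eqP; right.
Qed.
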